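(* Let $G=\mathrm{GL}_n$, $\mu=(1,0,\dots,0)$ and $\eta=x_1^n\in R^{W_\mu}$. Then $$\nabla^\eta_\mu(e_i)=(-1)^{n-1}e_i\qquad\text{for all }i=1,2,\dots,n.$$ In particular, the eigenweights are $\epsilon_i(\eta,\mu)=(-1)^{n-1}$ for each $i=1,\dots,n$.
   Context: $R=\overline{\mathbf Q}_\ell[x_1,\dots,x_n]$ with $x_i$ in degree 2, $W=S_n$ permuting variables, $R^W=\overline{\mathbf Q}_\ell[e_1,\dots,e_n]$ with $e_i$ the elementary symmetric polynomials. $W_\mu=S_{n-1}$ is the stabilizer of $x_1$, $P_\mu\subset G$ the parabolic whose roots $\alpha$ satisfy $\langle\alpha,\mu\rangle\ge0$ (so $G/P_\mu\cong\mathbb P^{n-1}$ with $x_1=c_1(\mathcal O(-1))$), $H^*(\mathbb BP_\mu)=R^{W_\mu}$, $\partial_\mu=\partial_{x_1}$. $\int_{G/P_\mu}:R^{W_\mu}\to R^W$ is pushforward in cohomology along $\mathbb BP_\mu\to\mathbb BG$, explicitly $f\mapsto\sum_{w\in W/W_\mu}w\big(f/\prod_{j=2}^n(x_j-x_1)\big)$. $\nabla^\eta_\mu:R^W\to R^W$, $f\mapsto\int_{G/P_\mu}\eta\cdot\partial_\mu f$, is a degree-preserving derivation; $\overline\nabla^\eta_\mu$ is the induced endomorphism of $R^W_+/(R^W_+)^2$, and $\epsilon_i(\eta,\mu)$ is its eigenvalue on the class of $e_i$. *)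

(* Defs.v *)
From HB Require Import structures.
From mathcomp Require Import all_boot all_order all_algebra all_fingroup.
From mathcomp Require Import boolp.
From mathcomp Require Import mpoly.

Set Implicit Arguments.
Unset Strict Implicit.
Unset Printing Implicit Defensive.

Import GRing.Theory.
Local Open Scope ring_scope.
Local Open Scope quotient_scope.

Section Invariants.
Variables (F : fieldType) (n : nat).
Implicit Types (H : {group 'S_n}) (p : {mpoly F[n]}).

Definition inv_pred H : pred {mpoly F[n]} :=
  fun p => [forall s in H, msym s p == p].

Lemma inv_predP H p :
  reflect (forall s, s \in H -> msym s p = p) (p \in inv_pred H).
Proof. exact: 'forall_in_eqP. Qed.

Fact inv_subring_closed H : subring_closed (inv_pred H).
Proof.
split=> [|p q /inv_predP hp /inv_predP hq|p q /inv_predP hp /inv_predP hq];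
  apply/inv_predP => s sH.
- exact: msym1.
- by rewrite msymB hp ?hq.
- by rewrite msymM hp ?hq.
Qed.
Fact inv_submod_closed H : submod_closed (inv_pred H).
Proof.
split=> [|c p q /inv_predP hp /inv_predP hq]; apply/inv_predP => s sH.
- exact: msym0.
- by rewrite msymD msymZ hp ?hq.
Qed.
HB.instance Definition _ H :=
  GRing.isSubringClosed.Build {mpoly F[n]} (inv_pred H) (inv_subring_closed H).
HB.instance Definition _ H :=
  GRing.isSubmodClosed.Build F {mpoly F[n]} (inv_pred H) (inv_submod_closed H).

(* The invariant ring R^H, where s in H maps x_i to x_(s i) (this is [msym s]). *)
Record invpoly H := InvPoly {
  inv_val :> {mpoly F[n]};
  inv_valP : inv_val \in inv_pred H }.

HB.instance Definition _ H := [isSub for @inv_val H].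
HB.instance Definition _ H := [Choice of invpoly H by <:].
HB.instance Definition _ H := [SubChoice_isSubComNzRing of invpoly H by <:].
HB.instance Definition _ H := [SubZmodule_isSubLmodule of invpoly H by <:].
HB.instance Definition _ H := [SubNzRing_SubLmodule_isSubLalgebra of invpoly H by <:].
HB.instance Definition _ H := [SubLalgebra_isSubAlgebra of invpoly H by <:].

Fact inv_valD H (f g : invpoly H) : val (f + g) = val f + val g.
Proof. by []. Qed.
Fact inv_valM H (f g : invpoly H) : val (f * g) = val f * val g.
Proof. by []. Qed.
Fact inv_valZ H c (f : invpoly H) : val (c *: f) = c *: val f.
Proof. by []. Qed.
End Invariants.

Section Integrality.
Variables (F : fieldType) (n : nat).
Local Notation R := {mpoly F[n]}.
Implicit Types (p q : R) (s : 'S_n) (i j a b : 'I_n).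

(* For i the index of x_1 this is (x_2 - x_1) ... (x_n - x_1). *)
Definition tangent_euler i : R := \prod_(j | j != i) ('X_j - 'X_i).

Fact msymXU s i : msym s 'X_i = 'X_(s i) :> R.
Proof. by rewrite /msym mmapX mmap1U. Qed.

Fact msym_euler s i : msym s (tangent_euler i) = tangent_euler (s i).
Proof.
rewrite rmorph_prod /= [RHS](reindex_inj (@perm_inj _ s)) /=.
apply: eq_big => [j|j _]; first by rewrite (inj_eq perm_inj).
by rewrite msymB !msymXU.
Qed.

Fact mpolyXU_inj i j : 'X_i = 'X_j :> R -> i = j.
Proof.
move/(congr1 (mcoeff U_(i))); rewrite !mcoeffX eqxx /=.
case: eqP => [/(congr1 (fun m : 'X_{1.. n} => m i))|_ /eqP]; last by rewrite oner_eq0.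
by rewrite !mnm1E eqxx; case: eqP.
Qed.

Fact euler_neq0 i : tangent_euler i != 0.
Proof.
apply/prodf_neq0 => j ji; rewrite subr_eq0; apply: contraNneq ji.
by move/mpolyXU_inj->.
Qed.

Let vdm : 'M[R]_n := Vandermonde n (\row_i 'X_i).
Let delta : R := \det vdm.

Let delta_prod : delta = \prod_(i < n) \prod_(j < n | (i < j)%N) ('X_j - 'X_i).
Proof.
rewrite /delta det_Vandermonde; apply: eq_bigr => i _; apply: eq_bigr => j _.
by rewrite !mxE.
Qed.

Let delta_neq0 : delta != 0.
Proof.
rewrite delta_prod; apply/prodf_neq0 => i _; apply/prodf_neq0 => j ij.
rewrite subr_eq0; apply: contraTneq ij => /mpolyXU_inj->.
by rewrite ltnn.
Qed.

Let msym_delta s : msym s delta = (-1) ^+ s * delta.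
Proof.
rewrite /delta -det_map_mx.
have -> : map_mx (msym s) vdm = col_perm s vdm.
  by apply/matrixP => i j; rewrite !mxE rmorphXn /= msymXU.
by rewrite col_permE det_mulmx det_perm odd_permV mulrC.
Qed.

(* Identification of the variables x_a and x_b. *)
Let glue a b p : R := p \mPo [tuple 'X_(if i == a then b else i) | i < n].

Let glueX a b i : glue a b 'X_i = 'X_(if i == a then b else i).
Proof. by rewrite /glue comp_mpolyXU -tnth_nth tnth_mktuple. Qed.

Let glue_tperm a b p : glue a b (msym (tperm a b) p) = glue a b p.
Proof.
rewrite /glue msym_mPo; congr (_ \mPo _); apply: eq_from_tnth => i.
rewrite !tnth_mktuple; congr 'X__.
case: tpermP => [->|->|]; rewrite ?eqxx //; first by case: eqP.
by case: eqP.
Qed.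

Let glue_dvd a b p : exists q, p - glue a b p = q * ('X_b - 'X_a).
Proof.
pose P p := exists q, p - glue a b p = q * ('X_b - 'X_a).
have PM p1 p2 : P p1 -> P p2 -> P (p1 * p2).
  move=> [q1 e1] [q2 e2]; exists (q1 * p2 + glue a b p1 * q2).
  rewrite {1}/glue rmorphM /= -!/(glue _ _ _) mulrDl mulrAC -e1 -mulrA -e2.
  by rewrite mulrBl mulrBr addrA subrK.
have P1 : P 1 by exists 0; rewrite /glue rmorph1 subrr mul0r.
have PX i : P 'X_i.
  rewrite /P glueX; case: eqP => [->|_]; last by exists 0; rewrite subrr mul0r.
  by exists (-1); rewrite mulN1r opprB.
have PXm m : P 'X_[m].
  rewrite mpolyXE_id; apply: big_ind => // i _.
  elim: (m i) => [|k IH]; first by rewrite expr0.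
  by rewrite exprS; apply: PM.
rewrite -/(P p); elim/mpolyind: p => [|c m p _ _ [q e]].
  by exists 0; rewrite /glue raddf0 subrr mul0r.
have [r er] := PXm m; exists (c *: r + q).
rewrite {1}/glue linearD linearZ /= -!/(glue _ _ _) mulrDl -scalerAl -er -e.
by rewrite scalerBr opprD addrACA.
Qed.

Let prod_dvd (l : seq ('I_n * 'I_n)) p :
    uniq l -> {in l, forall ab, (ab.2, ab.1) \notin l} ->
    {in l, forall ab, glue ab.1 ab.2 p = 0} ->
  exists q, p = q * \prod_(ab <- l) ('X_ab.2 - 'X_ab.1).
Proof.
elim: l p => [|[a b] l IH] p /=; first by exists p; rewrite big_nil mulr1.
move=> /andP[abl ul] asym gl.
have [||q ep] := IH p ul.
- by move=> ab abin; have := asym ab; rewrite !inE abin orbT negb_or => /(_ isT)/andP[].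
- by move=> ab abin; apply: gl; rewrite inE abin orbT.
have neq_ab : a != b.
  apply: contraNneq (asym _ (mem_head _ _)) => /= ->; exact: mem_head.
have /(gl (a, b)) /= : (a, b) \in (a, b) :: l by exact: mem_head.
rewrite {1}ep /glue rmorphM /= -!/(glue _ _ _) => /eqP; rewrite mulf_eq0.
have /negPf -> : glue a b (\prod_(cd <- l) ('X_cd.2 - 'X_cd.1)) != 0.
  rewrite /glue rmorph_prod /= prodf_seq_neq0; apply/allP => -[c d] cdl /=.
  rewrite raddfB /= -!/(glue _ _ _) !glueX subr_eq0.
  apply/eqP => /mpolyXU_inj.
  have cdab : (c, d) != (a, b) by apply: contraNneq abl => <-.
  have cdba : (c, d) != (b, a).
    apply: contraNneq (asym _ (mem_head _ _)) => /= <-.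
    by rewrite inE cdl orbT.
  have cd : c != d.
    apply/eqP => ecd; have := asym (c, d); subst d; rewrite !inE cdl orbT /=.
    by move/(_ isT).
  move: cdab cdba cd; rewrite !xpair_eqE /=.
  case: (eqVneq d a) => [->|_]; case: (eqVneq c a) => [->|_] /=.
  - by [].
  - by rewrite andbT => _ /negPf cb _ ebc; rewrite -ebc eqxx in cb.
  - by move=> /negPf db _ _ edb; rewrite edb eqxx in db.
  - by move=> _ _ /negPf cd edc; rewrite edc eqxx in cd.
rewrite orbF => /eqP gq0; have [r er] := glue_dvd a b q.
exists r; rewrite ep big_cons mulrA; congr (_ * _).
by rewrite -er gq0 subr0.
Qed.

Let glue_delta a b : a != b -> glue a b delta = 0.
Proof.
move=> ab; rewrite /glue delta_prod rmorph_prod /=.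
wlog lt_ab : / (a < b)%N \/ (b < a)%N.
  by apply; apply/orP; rewrite -neq_ltn.
case: lt_ab => lt_ab.
  rewrite (bigD1 a) //= rmorph_prod /= (bigD1 b) //= raddfB /= -!/(glue _ _ _).
  by rewrite !glueX eqxx eq_sym (negPf ab) subrr !mul0r.
rewrite (bigD1 b) //= rmorph_prod /= (bigD1 a) //= raddfB /= -!/(glue _ _ _).
by rewrite !glueX eqxx eq_sym (negPf ab) subrr !mul0r.
Qed.

Let cofactor i : exists q, delta = q * tangent_euler i.
Proof.
have [|||q ->] := @prod_dvd [seq (i, j) | j <- enum 'I_n & j != i] delta.
- by rewrite map_inj_uniq ?filter_uniq -?enumT ?enum_uniq // => ? ? [].
- move=> ? /mapP[j]; rewrite mem_filter => /andP[ji _] -> /=.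
  by apply/negP => /mapP[k _ [eji _]]; rewrite eji eqxx in ji.
- move=> ? /mapP[j]; rewrite mem_filter => /andP[ji _] -> /=.
  by apply: glue_delta; rewrite eq_sym.
by exists q; rewrite big_map big_filter /= enumT.
Qed.

(* The poles of the sum along x_a = x_b cancel: multiplied by the Vandermonde
   determinant [delta], the sum is an alternating polynomial, hence divisible by
   [delta]. *)
Fact localization_integral (g : 'I_n -> R) :
    (forall s i, msym s (g i) = g (s i)) ->
  exists2 p, forall s, msym s p = p &
    FracField.tofrac p =
      \sum_i FracField.tofrac (g i) / FracField.tofrac (tangent_euler i).
Proof.
move=> gE; pose M i := projT1 (cid (cofactor i)).
have ME i : delta = M i * tangent_euler i by rewrite /M; case: cid.
pose N i := g i * M i.
have msymN s i : msym s (N i) = (-1) ^+ s * N (s i).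
  apply: (mulIf (euler_neq0 (s i))).
  rewrite -{1}msym_euler -msymM -/(N i) /N -mulrA -ME msymM gE msym_delta.
  by rewrite [in LHS](ME (s i)) !mulrA; congr (_ * _ * _); rewrite mulrC.
have glueN a b : a != b -> glue a b (\sum_i N i) = 0.
  move=> ab; rewrite (bigD1 a) //= (bigD1 b) 1?eq_sym //= /glue 2!raddfD /=.
  rewrite raddf_sum /= big1 ?addr0 => [|i /andP[ia ib]].
    rewrite -!/(glue _ _ _) -[X in X + _]glue_tperm msymN tpermL.
    by rewrite odd_tperm ab expr1 mulN1r /glue raddfN addNr.
  have : glue a b (M i) * glue a b (tangent_euler i) = 0.
    by rewrite /glue -rmorphM /= -ME -/(glue _ _ _) glue_delta.
  move/eqP; rewrite mulf_eq0 orbC.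
  have /negPf -> : glue a b (tangent_euler i) != 0.
    rewrite /glue rmorph_prod; apply/prodf_neq0 => j ji /=.
    rewrite raddfB /= -!/(glue _ _ _) !glueX (negPf ia) subr_eq0.
    apply/eqP => /mpolyXU_inj; case: eqP => [_ /eqP|_ /eqP]; last by apply/negP.
    by rewrite eq_sym (negPf ib).
  by move=> /eqP gM0; rewrite /N rmorphM /= -!/(glue _ _ _) gM0 mulr0.
have [|||p ep] := @prod_dvd
    [seq ij : 'I_n * 'I_n <- enum {: 'I_n * 'I_n} | (ij.1 < ij.2)%N] (\sum_i N i).
- by rewrite filter_uniq ?enum_uniq.
- move=> [i j]; rewrite !mem_filter /= => /andP[ij _].
  by rewrite negb_and -leqNgt (ltnW ij).
- move=> [i j]; rewrite !mem_filter /= => /andP[ij _]; apply: glueN.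
  by apply: contraTneq ij => ->; rewrite ltnn.
have {}ep : \sum_i N i = p * delta.
  rewrite ep delta_prod big_filter big_enum_cond /=.
  by rewrite (pair_big_dep xpredT (fun i j : 'I_n => (i < j)%N)
       (fun i j => 'X_j - 'X_i)).
exists p => [s|].
  apply: (mulIf delta_neq0); apply: (@mulfI _ ((-1) ^+ s)).
    by rewrite signr_eq0.
  rewrite mulrCA -msym_delta -msymM -ep raddf_sum /= mulr_sumr.
  rewrite [RHS](reindex_inj (@perm_inj _ s)) /=.
  by apply: eq_bigr => i _; rewrite msymN.
have d0 : FracField.tofrac delta != 0 by rewrite tofrac_eq0.
apply: (mulIf d0); rewrite -tofracM -ep rmorph_sum /= mulr_suml.
apply: eq_bigr => i _; rewrite (ME i) /N !tofracM.
have e0 : FracField.tofrac (tangent_euler i) != 0 by rewrite tofrac_eq0 euler_neq0.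
by rewrite -[RHS]mulrA; congr (_ * _); rewrite mulrCA mulVf ?mulr1.
Qed.

Fact homog_prod (P : pred 'I_n) (G : 'I_n -> R) d :
  (forall i, P i -> G i \is d.-homog) ->
  \prod_(i | P i) G i \is (\sum_(i < n | P i) d)%N.-homog.
Proof.
move=> hG; elim/big_rec2: _ => [|i e p Pi hp]; first exact: dhomog1.
by apply: dhomogM => //; apply: hG.
Qed.

Fact euler_homog i : tangent_euler i \is (n.-1).-homog.
Proof.
have <- : (\sum_(j < n | j != i) 1 = n.-1)%N.
  by rewrite sum1_card cardC1 card_ord.
by apply: homog_prod => j _; apply: rpredB; rewrite dhomogX /= mdeg1.
Qed.

Fact pihomog_mulr (A h : R) e d : A \is e.-homog -> (d <= e)%N ->
  pihomog mdeg d (A * h) = (if d == e then h@_0%MM else 0) *: A.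
Proof.
move=> hA le_de; elim/mpolyind: h => [|c m p _ _ IH].
  by rewrite mulr0 pihomog0 mcoeff0 if_same scale0r.
rewrite mulrDr linearD /= IH mcoeffD mcoeffZ mcoeffX -scalerAr linearZ /=.
have hAm : A * 'X_[m] \is (e + mdeg m)%N.-homog.
  by apply: dhomogM => //; rewrite dhomogX.
case: (eqVneq m 0%MM) => [m0|m_neq0].
  move: hAm; rewrite m0 mdeg0 addn0 mpolyX0 !mulr1 => hA1.
  case: (eqVneq d e) => [->|ne]; first by rewrite pihomog_dE // scalerDl.
  by rewrite (pihomog_ne0 _ hA1) 1?eq_sym // scaler0 scale0r add0r.
rewrite mulr0 add0r (pihomog_ne0 _ hAm) ?scaler0 ?add0r //.
rewrite gtn_eqF // (leq_ltn_trans le_de) // -[X in (X < _)%N]addn0 ltn_add2l.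
by rewrite lt0n mdeg_eq0.
Qed.
End Integrality.

Section Eigenweights.
Variables (F : fieldType) (n : nat).
Local Notation "p %:F" := (FracField.tofrac p).

Local Notation RW := (invpoly F [set: 'S_n]).

Fact elemsym_inv k : mesym n F k \in inv_pred [set: 'S_n].
Proof. by apply/inv_predP => s _; apply/issymP/mesym_sym. Qed.
Definition elemsym k : RW := InvPoly (elemsym_inv k).

(* [i0] is the index of the variable x_1. *)
Variable i0 : 'I_n.

Definition Wmu : {group 'S_n} := 'C[i0 | 'P]%G.
Local Notation RWmu := (invpoly F Wmu).

Fact WmuP (s : 'S_n) : reflect (s i0 = i0) (s \in Wmu).
Proof. by apply: (iffP astab1P). Qed.

Fact xmu_inv : ('X_i0 : {mpoly F[n]}) \in inv_pred Wmu.
Proof. by apply/inv_predP => s /WmuP si0; rewrite msymXU si0. Qed.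
Definition xmu : RWmu := InvPoly xmu_inv.

(* The integral over G/P_mu, with values a priori in the fraction field, on which
   w acts by w(f/g) = msym w f / msym w g.  As ['S_n] composes from left to right
   ([msym (v * w) = msym w \o msym v]), the left coset w W_mu of the usual
   convention is the [rcoset] [Wmu :* w]. *)
Definition gysin_frac (f : RWmu) : {fraction {mpoly F[n]}} :=
  \sum_(C in rcosets Wmu [set: 'S_n])
    (msym (repr C) (val f))%:F / (msym (repr C) (tangent_euler F i0))%:F.

Fact msym_coset (f : RWmu) (v w : 'S_n) :
  v i0 = w i0 -> msym v (val f) = msym w (val f).
Proof.
move=> vw; rewrite -[v](mulgKV w) msymMm; congr (msym w _).
by case: f => p /= /inv_predP -> //; apply/WmuP; rewrite permM vw permK.
Qed.

Fact repr_rcoset (v : 'S_n) : repr (Wmu :* v)%g i0 = v i0.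
Proof.
by have /rcosetP[h /WmuP hi0 ->] := mem_repr_rcoset Wmu v; rewrite permM hi0.
Qed.

Fact gysin_fracE (f : RWmu) :
  gysin_frac f =
    \sum_i (msym (tperm i0 i) (val f))%:F / (tangent_euler F i)%:F.
Proof.
rewrite /gysin_frac.
rewrite (reindex_onto (fun i => (Wmu :* tperm i0 i)%g) (fun C => repr C i0)) /=.
  apply: eq_big => [i|i _].
    by rewrite -rcosetE imset_f ?inE //= rcosetE repr_rcoset tpermL eqxx.
  by rewrite msym_euler (msym_coset _ (repr_rcoset _)) repr_rcoset tpermL.
move=> _ /rcosetsP[v _ ->]; rewrite repr_rcoset; apply/rcoset_eqP.
by rewrite mem_rcoset; apply/WmuP; rewrite permM tpermL permK.
Qed.

Fact gysin_integral (f : RWmu) : {p : RW | (val p)%:F = gysin_frac f}.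
Proof.
apply: cid.
have [|p sym_p ep] := @localization_integral F n (fun i => msym (tperm i0 i) (val f)).
  by move=> s i; rewrite -msymMm; apply: msym_coset; rewrite permM !tpermL.
have pP : p \in inv_pred [set: 'S_n] by apply/inv_predP => s _.
by exists (InvPoly pP); rewrite gysin_fracE -ep.
Qed.

(* Uniquely determined by [gysinE], as the polynomials embed in their fractions. *)
Definition gysin (f : RWmu) : RW := sval (gysin_integral f).

Fact gysinE (f : RWmu) : (val (gysin f))%:F = gysin_frac f.
Proof. exact: svalP (gysin_integral f). Qed.

Fact msym_mderiv (s : 'S_n) i (p : {mpoly F[n]}) :
  msym s p^`M(i) = (msym s p)^`M(s i).
Proof.
apply/mpolyP => m; rewrite mcoeff_sym !mcoeff_mderiv mcoeff_sym mnmE.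
congr (p@__ *+ _); apply/mnmP => j; rewrite !mnmE.
by rewrite (inj_eq perm_inj).
Qed.

Fact dmu_inv (f : RW) : (val f)^`M(i0) \in inv_pred Wmu.
Proof.
apply/inv_predP => s /WmuP si0; rewrite msym_mderiv si0.
by case: f => p /= /inv_predP ->; rewrite ?inE.
Qed.
Definition dmu (f : RW) : RWmu := InvPoly (dmu_inv f).

Definition nabla (eta : RWmu) (f : RW) : RW := gysin (eta * dmu f).

(* R^W_+, the part of positive degree: the invariants without constant term. *)
Definition Rplus_pred : pred RW := fun f => (val f)@_0%MM == 0.

Fact Rplus_submod_closed : submod_closed Rplus_pred.
Proof.
split=> [|c f g /eqP hf /eqP hg]; first by rewrite /in_mem /= /Rplus_pred mcoeff0.
by rewrite /in_mem /= /Rplus_pred linearD /= linearZ /= hf hg mulr0 addr0.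
Qed.
HB.instance Definition _ :=
  GRing.isSubmodClosed.Build F RW Rplus_pred Rplus_submod_closed.

Record Rplus := InRplus { Rplus_val :> RW; _ : Rplus_val \in Rplus_pred }.
HB.instance Definition _ := [isSub for Rplus_val].
HB.instance Definition _ := [Choice of Rplus by <:].
HB.instance Definition _ := [SubChoice_isSubZmodule of Rplus by <:].
HB.instance Definition _ := [SubZmodule_isSubLmodule of Rplus by <:].

(* (R^W_+)^2: the finite sums of products of two elements of R^W_+. *)
Definition Rplus2_pred : pred Rplus := fun f =>
  `[< exists l : seq (Rplus * Rplus), val f = \sum_(gh <- l) val gh.1 * val gh.2 >].

Fact Rplus2_submod_closed : submod_closed Rplus2_pred.
Proof.
split=> [|c f g /asboolP[lf ef] /asboolP[lg eg]]; apply/asboolP.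
  by exists [::]; rewrite big_nil.
exists ([seq (c *: gh.1, gh.2) | gh <- lf] ++ lg).
rewrite big_cat big_map /= -eg; congr (_ + _).
rewrite /= [val f]ef scaler_sumr; apply: eq_bigr => gh _.
by rewrite -scalerAl.
Qed.
HB.instance Definition _ :=
  GRing.isSubmodClosed.Build F Rplus Rplus2_pred Rplus2_submod_closed.

(* The F-vector space R^W_+ / (R^W_+)^2. *)
Definition indec :=
  Quotient.quot (GRing.ZmodClosed.clone Rplus Rplus2_pred _).
HB.instance Definition _ := GRing.Zmodule.on indec.
HB.instance Definition _ := EqQuotient.on indec.

Definition scaleq (c : F) : indec -> indec := lift_op1 indec ( *:%R c).

Fact pi_scaleq c (f : Rplus) : scaleq c (\pi_indec f) = \pi_indec (c *: f).
Proof.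
rewrite /scaleq; unlock; apply/eqP; rewrite -Quotient.idealrBE -scalerBr.
by apply: rpredZ; rewrite /= Quotient.idealrBE reprK.
Qed.

Fact scaleqA a b (x : indec) : scaleq a (scaleq b x) = scaleq (a * b) x.
Proof. by elim/quotW: x => f; rewrite !pi_scaleq scalerA. Qed.
Fact scaleq1 : left_id 1 scaleq.
Proof. by elim/quotW => f; rewrite pi_scaleq scale1r. Qed.
Fact scaleqDr : right_distributive scaleq +%R.
Proof.
move=> c x y; elim/quotW: x => f; elim/quotW: y => g.
by rewrite -raddfD !pi_scaleq scalerDr raddfD.
Qed.
Fact scaleqDl (x : indec) : {morph scaleq^~ x : a b / a + b}.
Proof.
by move=> a b; elim/quotW: x => f; rewrite !pi_scaleq scalerDl raddfD.
Qed.
HB.instance Definition _ :=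
  GRing.Zmodule_isLmodule.Build F indec scaleqA scaleq1 scaleqDr scaleqDl.

Fact dmuD : {morph dmu : f g / f + g}.
Proof. by move=> f g; apply: val_inj; rewrite /= mderivD. Qed.

Fact dmuZ c : {morph dmu : f / c *: f}.
Proof. by move=> f; apply: val_inj; rewrite /= mderivZ. Qed.

Fact gysin_eq (f : RWmu) (p : RW) : (val p)%:F = gysin_frac f -> gysin f = p.
Proof.
rewrite -gysinE => /eqP; rewrite tofrac_eq => /eqP epf.
by apply: val_inj; rewrite epf.
Qed.

Fact gysinD : {morph gysin : f g / f + g}.
Proof.
move=> f g; apply: gysin_eq.
have -> : gysin_frac (f + g) = gysin_frac f + gysin_frac g.
  rewrite /gysin_frac -big_split; apply: eq_bigr => C _.
  by rewrite inv_valD msymD tofracD mulrDl.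
by rewrite -(gysinE f) -(gysinE g) -tofracD.
Qed.

Fact gysin_linear (f : RWmu) (c : RW) (h : RWmu) :
  val h = val c -> gysin (f * h) = gysin f * c.
Proof.
move=> hc; apply: gysin_eq.
have -> : gysin_frac (f * h) = gysin_frac f * (val c)%:F.
  rewrite /gysin_frac mulr_suml; apply: eq_bigr => C _.
  rewrite inv_valM hc msymM tofracM mulrAC.
  suff -> : msym (repr C) (val c) = val c by [].
  by case: c {hc} => c /= /inv_predP ->; rewrite ?inE.
by rewrite -(gysinE f) -tofracM.
Qed.

Fact nablaD eta : {morph nabla eta : f g / f + g}.
Proof. by move=> f g; rewrite /nabla dmuD mulrDr gysinD. Qed.

Fact RW_RWmu (f : RW) : val f \in inv_pred Wmu.
Proof. by case: f => p /= /inv_predP hp; apply/inv_predP => s _; rewrite hp ?inE. Qed.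

Fact nablaZ eta (c : F) : {morph nabla eta : f / c *: f}.
Proof.
move=> f; rewrite /nabla dmuZ.
have -> : eta * (c *: dmu f) = eta * dmu f * c%:A by rewrite -scalerAr mulr_algr.
by rewrite (@gysin_linear _ c%:A) ?mulr_algr //= ?linearZ.
Qed.

Fact nablaM eta f g : nabla eta (f * g) = nabla eta f * g + f * nabla eta g.
Proof.
pose f' := InvPoly (RW_RWmu f); pose g' := InvPoly (RW_RWmu g).
have -> : nabla eta (f * g) = gysin (eta * dmu f * g' + eta * dmu g * f').
  rewrite /nabla; congr gysin; rewrite -!mulrA -mulrDr; congr (_ * _).
  by apply: val_inj; rewrite /= mderivM [X in _ + X]mulrC.
rewrite gysinD (@gysin_linear _ g g') // (@gysin_linear _ f f') //.
by rewrite [X in _ + X]mulrC.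
Qed.

(* Polynomial degree n (cohomological degree 2n) for eta is what makes nabla
   preserve degrees: the derivative lowers the polynomial degree by 1 and the
   integral lowers it by n - 1. *)
Section Induced.
Variables (eta : RWmu) (eta_homog : val eta \is n.-homog).

Fact nabla_Rplus (f : Rplus) : nabla eta (val f) \in Rplus_pred.
Proof.
apply/eqP; have := gysinE (eta * dmu (val f)); rewrite /nabla.
move: (val (gysin _)) => p ep.
pose D : {mpoly F[n]} := \prod_i tangent_euler F i.
pose Q i : {mpoly F[n]} :=
  msym (tperm i0 i) (val eta) * \prod_(k | k != i) tangent_euler F k.
pose h i : {mpoly F[n]} := msym (tperm i0 i) (val (dmu (val f))).
have fieldE (K : fieldType) (x y z t : K) :
    x != 0 -> x * y * (z * t / x) = z * y * t.
  by move=> x0; rewrite mulrC mulrA divfK // mulrAC.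
have e0 (i : 'I_n) : (tangent_euler F i)%:F != 0 by rewrite tofrac_eq0 euler_neq0.
have eD : D * p = \sum_i Q i * h i.
  apply/eqP; rewrite -tofrac_eq; apply/eqP.
  rewrite tofracM ep gysin_fracE rmorph_sum mulr_sumr; apply: eq_bigr => i _.
  transitivity ((Q i)%:F * (h i)%:F); last by rewrite -tofracM.
  rewrite /D (bigD1 i) // inv_valM msymM /Q /h !tofracM.
  by apply: (fieldE _ _ _ _ _ (e0 i)).
have D0 : D != 0 by apply/prodf_neq0 => i _; apply: euler_neq0.
have n_gt0 : (0 < n)%N by apply: leq_ltn_trans (ltn_ord i0).
have hE (i : 'I_n) : tangent_euler F i \is (n.-1).-homog.
  exact: euler_homog.
have hD : D \is (\sum_(i < n) n.-1)%N.-homog by apply: homog_prod.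
have hQ i : Q i \is (n + \sum_(k < n | k != i) n.-1)%N.-homog.
  apply: dhomogM; last exact: homog_prod.
  by rewrite homog_piE -msym_pihomog (pihomog_dE eta_homog).
have := congr1 (pihomog mdeg (\sum_(i < n) n.-1)%N) eD.
rewrite (pihomog_mulr _ hD) // eqxx raddf_sum /= big1 => [/eqP|i _].
  by rewrite scaler_eq0 => /orP[/eqP//|]; rewrite (negPf D0).
have lt_d : (\sum_(i < n) n.-1 < n + \sum_(k < n | k != i) n.-1)%N.
  by rewrite [X in (X < _)%N](bigD1 i) //= -addSn prednK.
by rewrite (pihomog_mulr _ (hQ i)) ?(ltnW lt_d) // ltn_eqF // scale0r.
Qed.
Definition nabla_plus (f : Rplus) : Rplus := InRplus (nabla_Rplus f).

(* Independent of the representative by [nabla_barE], and F-linear by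
   [nabla_bar_linear]. *)
Definition nabla_bar : indec -> indec := lift_op1 indec nabla_plus.

Fact nabla_plusB : {morph nabla_plus : f g / f - g}.
Proof.
move=> f g; apply: val_inj; rewrite /= -[- Rplus_val g]scaleN1r.
by rewrite nablaD nablaZ scaleN1r.
Qed.

Fact nabla_plus_Rplus2 (f : Rplus) :
  f \in Rplus2_pred -> nabla_plus f \in Rplus2_pred.
Proof.
move=> /asboolP[l ef]; apply/asboolP.
exists ([seq (nabla_plus gh.1, gh.2) | gh <- l] ++
        [seq (gh.1, nabla_plus gh.2) | gh <- l]).
rewrite big_cat !big_map /= [Rplus_val f]ef -big_split /=.
elim: l {f ef} => [|gh l IH]; last by rewrite !big_cons nablaD nablaM IH.
rewrite !big_nil; have := nablaZ eta 0 0; by rewrite !scale0r.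
Qed.

Fact nabla_barE (f : Rplus) : nabla_bar (\pi_indec f) = \pi_indec (nabla_plus f).
Proof.
rewrite /nabla_bar; unlock; apply/eqP; rewrite -Quotient.idealrBE -nabla_plusB.
by apply: nabla_plus_Rplus2; rewrite Quotient.idealrBE reprK.
Qed.

Fact nabla_bar_linear : linear nabla_bar.
Proof.
move=> c x y; elim/quotW: x => f; elim/quotW: y => g.
have <- : scaleq c (\pi_indec f) = c *: \pi_indec f by [].
have <- : scaleq c (nabla_bar (\pi_indec f)) = c *: nabla_bar (\pi_indec f) by [].
rewrite pi_scaleq -raddfD !nabla_barE pi_scaleq -raddfD /=; congr (\pi_indec _).
by apply: val_inj; rewrite /= nablaD nablaZ.
Qed.

End Induced.

Fact elemsym_Rplus k : elemsym k.+1 \in Rplus_pred.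
Proof.
apply/eqP; rewrite /= mcoeff_mesym /mechar mdeg0.
by rewrite eqE.
Qed.
Definition elemsym_plus k : Rplus := InRplus (elemsym_Rplus k).

Fact xmuXn_homog : val (xmu ^+ n) \is n.-homog.
Proof.
have -> : val (xmu ^+ n) = 'X_[U_(i0) *+ n] :> {mpoly F[n]}.
  by rewrite rmorphXn /= mpolyXn.
by rewrite dhomogX /= mdegMn mdeg1 mul1n.
Qed.

(* epsilon_{i+1}(eta, mu) = c, for [i : 'I_n] numbered from 0. *)
Definition is_eigenweight eta (eta_homog : val eta \is n.-homog)
    (i : 'I_n) (c : F) : Prop :=
  let cls : indec := \pi_indec (elemsym_plus i) in
  cls != 0 /\ nabla_bar eta_homog cls = c *: cls.

End Eigenweights.

(* Main.v *)
Require Import Defs.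
From mathcomp Require Import all_boot all_order all_algebra all_fingroup.
From mathcomp Require Import boolp.
From mathcomp Require Import mpoly.

(* Put P(z) = prod_k (z - x_k) and Q_j(z) = P(z) / (z - x_j).  Lagrange
   interpolation of z^n at x_1, ..., x_n gives
     z^n - P(z) = sum_j x_j^n Q_j(z) / prod_(k != j) (x_j - x_k),
   and dP/dx_j = - Q_j.  The coefficient of z^(n-i) in P is (-1)^i e_i, so
   comparing these coefficients gives
     e_i = sum_j x_j^n (d e_i / d x_j) / prod_(k != j) (x_j - x_k),
   and the sum is nabla(e_i) up to the sign (-1)^(n-1) from reversing the n - 1
   factors of each denominator.

   The class of e_i is nonzero because R^W is a polynomial ring in e_1, ..., e_n:
   a product of two polynomials in the e_j without constant term has no linear
   term. *)

Set Implicit Arguments.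
Unset Strict Implicit.
Unset Printing Implicit Defensive.

Import GRing.Theory.
Local Open Scope ring_scope.

(** The leading terms of ['X^n] and of the monic product cancel, so the difference of the two sides
    has degree below n; it vanishes at the n distinct points [x j]. *)
Lemma lagrange_Xn (K : fieldType) (n : nat) (x : 'I_n -> K) : injective x ->
  'X^n - \prod_k ('X - (x k)%:P) =
  \sum_j (x j ^+ n / \prod_(k | k != j) (x j - x k)) *:
           \prod_(k | k != j) ('X - (x k)%:P).
Proof.
move=> x_inj; apply/eqP; rewrite -subr_eq0.
set P := \prod_k _; set S := \sum_j _; apply/eqP.
have evQ i j : (\prod_(k | k != j) ('X - (x k)%:P)).[x i] =
    \prod_(k | k != j) (x i - x k).
  by rewrite horner_prod; apply: eq_bigr => k _; rewrite !hornerE.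
apply: (@roots_geq_poly_eq0 _ _ [seq x j | j <- enum 'I_n]).
- apply/allP => _ /mapP[j _ ->]; rewrite /root !hornerE.
  have -> : P.[x j] = 0.
    by rewrite horner_prod (bigD1 j) //= !hornerE subrr mul0r.
  rewrite subr0 horner_sum (bigD1 j) //= [X in _ - (_ + X)]big1 ?addr0 => [|i ij].
    rewrite hornerZ evQ divfK ?subrr //.
    apply/prodf_neq0 => k kj; rewrite subr_eq0.
    by apply: contraNneq kj => /x_inj ->.
  rewrite hornerZ evQ [X in _ * X](bigD1 j) 1?eq_sym //= subrr mul0r.
  by rewrite mulr0.
- by rewrite map_inj_uniq ?enum_uniq.
rewrite size_map size_enum_ord; apply/leq_sizeP => m le_nm.
rewrite coefB /S coef_sum big1 ?subr0 => [|j _].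
  have szP : size P = n.+1 by rewrite /P -big_enum size_prod_XsubC size_enum_ord.
  have monP : P \is monic by apply: monic_prod => k _; apply: monicXsubC.
  rewrite coefB coefXn; move: le_nm; rewrite leq_eqVlt.
  case/predU1P=> [<-|lt_nm].
    by move/monicP: monP; rewrite eqxx lead_coefE szP /= => ->; rewrite subrr.
  by rewrite gtn_eqF // nth_default ?szP // subrr.
rewrite coefZ nth_default ?mulr0 //.
rewrite (eq_bigl (mem (predC1 j))) // -big_enum size_prod_XsubC -cardE cardC1 card_ord.
by rewrite prednK // (leq_ltn_trans _ (ltn_ord j)).
Qed.

Lemma lagrange_coef (K : fieldType) (n : nat) (x : 'I_n -> K) (m : nat) :
  injective x -> (m < n)%N ->
  (\prod_k ('X - (x k)%:P))`_m =
  - \sum_j (x j ^+ n / \prod_(k | k != j) (x j - x k)) *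
             (\prod_(k | k != j) ('X - (x k)%:P))`_m.
Proof.
move=> x_inj lt_mn.
have /(congr1 (fun p : {poly K} => p`_m)) := lagrange_Xn x_inj.
rewrite coefB coefXn ltn_eqF // sub0r coef_sum => /eqP; rewrite eqr_oppLR => /eqP->.
by congr (- _); apply: eq_bigr => j _; rewrite coefZ.
Qed.

Section Symmetric.
Variables (F : fieldType) (n : nat).
Local Notation R := {mpoly F[n]}.

Lemma coef_prod_XsubX (k : 'I_n.+1) :
  (\prod_i ('X - ('X_i : R)%:P))`_(n - k) = (-1) ^+ k * mesym n F k.
Proof.
pose X : n.-tuple R := [tuple ('X_i : R) | i < n].
have XE i : tnth X i = 'X_i by rewrite tnth_mktuple.
have eX : \prod_(c <- X) ('X - c%:P) = \prod_i ('X - ('X_i : R)%:P).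
  by rewrite big_tuple; apply: eq_bigr => i _; rewrite XE.
(* [mroots_coeff] yields [mesym] with coefficients in [R], evaluated at the variables; monomial by
   monomial this is [mesym] over [F]. *)
rewrite -eX (mroots_coeff X k); congr (_ * _); rewrite !mesymE raddf_sum /=.
apply: eq_bigr => h _; rewrite mevalX [RHS]mpolyXE_id.
by apply: eq_bigr => i _; rewrite XE.
Qed.

Lemma mderiv_coef_prod_XsubX_notin (P : pred 'I_n) (j : 'I_n) (m : nat) : ~~ P j ->
  ((\prod_(k | P k) ('X - ('X_k : R)%:P))`_m)^`M(j) = 0.
Proof.
move=> Pj; elim/big_rec: _ m => [|k p Pk IH] m.
  by rewrite coef1 mderivMn -mpolyC1 mderivC mul0rn.
rewrite mulrBl coefB coefXM coefCM mderivB mderivM !IH mulr0 addr0.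
rewrite mderivX mnm1E; have /negPf-> : k != j by apply: contraNneq Pj => <-.
rewrite scale0r mul0r subr0.
by case: eqP => _; rewrite ?mderiv0 ?IH.
Qed.

(** Only the factor at k = j involves ['X_j], and its derivative in that variable is -1. *)
Lemma mderiv_coef_prod_XsubX (j : 'I_n) (m : nat) :
  ((\prod_k ('X - ('X_k : R)%:P))`_m)^`M(j) =
    - (\prod_(k | k != j) ('X - ('X_k : R)%:P))`_m.
Proof.
rewrite (bigD1 j) //= mulrBl coefB coefXM coefCM mderivB mderivM.
rewrite !mderiv_coef_prod_XsubX_notin ?negbK ?eqxx // mulr0 addr0.
rewrite mderivX mnm1E eqxx scale1r.
have -> : (U_(j) - U_(j))%MM = 0%MM by apply/mnmP => i; rewrite mnmBE mnm0E subnn.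
rewrite mpolyX0 mul1r.
by case: (m == 0%N); rewrite ?mderiv0 ?mderiv_coef_prod_XsubX_notin ?negbK ?eqxx // sub0r.
Qed.

End Symmetric.

Section Nabla.
Variables (F : fieldType) (n : nat) (i0 : 'I_n).
Local Notation R := {mpoly F[n]}.

Lemma nabla_xmuXn_elemsym (i : 'I_n) :
  nabla (xmu F i0 ^+ n) (elemsym F n i.+1) = (-1) ^+ n.-1 *: elemsym F n i.+1.
Proof.
(* The identity is checked in the fraction field, where the cosets are indexed by the image j of
   [i0] and Lagrange interpolation at the variables makes sense. *)
apply: gysin_eq; rewrite gysin_fracE.
pose x j : {fraction R} := FracField.tofrac 'X_j.
have x_inj : injective x.
  by move=> j k /eqP; rewrite tofrac_eq => /eqP /mpolyXU_inj.
pose P : {poly R} := \prod_k ('X - ('X_k)%:P).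
pose Q j : {poly R} := \prod_(k | k != j) ('X - ('X_k)%:P).
(* The coefficient of z^m in P is e_(i+1) up to sign, and m < n because i + 1 > 0, so ['X^n] does
   not contribute to it. *)
pose m := (n - i.+1)%N.
(* Interpolation takes place over the fractions and differentiation over [R]; this passes between
   the two. *)
have tofrac_coef (A : pred 'I_n) :
    (\prod_(k | A k) ('X - (x k)%:P))`_m =
    FracField.tofrac (\prod_(k | A k) ('X - ('X_k : R)%:P))`_m.
  transitivity (map_poly (@FracField.tofrac R)
      (\prod_(k | A k) ('X - ('X_k : R)%:P)))`_m; last exact: coef_map.
  congr ((_ : {poly _})`_m); rewrite rmorph_prod.
  by apply: eq_bigr => k _; rewrite /= map_polyXsubC.
have eP : mesym n F i.+1 = (-1) ^+ i.+1 * P`_m.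
  have := coef_prod_XsubX F (Ordinal (ltn_ord i : (i.+1 < n.+1)%N)).
  by move=> /= ->; rewrite mulrA -expr2 sqrr_sign mul1r.
have lt_mn : (m < n)%N by rewrite ltn_subrL (leq_ltn_trans _ (ltn_ord i)).
have eL : FracField.tofrac P`_m =
    - \sum_j (x j ^+ n / \prod_(k | k != j) (x j - x k)) * FracField.tofrac (Q j)`_m.
  transitivity ((\prod_k ('X - (x k)%:P))`_m); first exact/esym/tofrac_coef.
  rewrite lagrange_coef //; congr (- _); apply: eq_bigr => j _; congr (_ * _).
  exact: tofrac_coef.
have signZ k (p : R) : (-1) ^+ k *: p = (-1) ^+ k * p.
  by rewrite -mul_mpolyC rmorphXn rmorphN1.
have eulerE j : FracField.tofrac (tangent_euler F j) =
    (-1) ^+ n.-1 * \prod_(k | k != j) (x j - x k).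
  rewrite -[in n.-1](card_ord n) -(cardC1 j) -prodrN rmorph_prod /=.
  by apply: eq_bigr => k _; rewrite opprB rmorphB.
(* The transposition sends [i0] to [j] and fixes the symmetric e_(i+1), so the numerator becomes
   x_j^n times the derivative of e_(i+1) in x_j. *)
have termE j : msym (tperm i0 j) (val (xmu F i0 ^+ n * dmu i0 (elemsym F n i.+1))) =
    (-1) ^+ i.+1 * - ('X_j ^+ n * (Q j)`_m).
  rewrite inv_valM [X in msym _ (X * _)]rmorphXn rmorphM rmorphXn /= msymXU tpermL.
  rewrite msym_mderiv tpermL (issymP _ (mesym_sym _ _ _)) eP.
  rewrite -[in LHS]signZ mderivZ mderiv_coef_prod_XsubX -/(Q j) signZ.
  by rewrite mulrCA mulrN.
transitivity ((-1) ^+ n.-1 * ((-1) ^+ i.+1 * FracField.tofrac P`_m)).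
  by rewrite inv_valZ /= eP signZ !rmorphM !rmorph_sign.
rewrite eL -sumrN !mulr_sumr; apply: eq_bigr => j _.
rewrite termE eulerE rmorphM rmorph_sign rmorphN rmorphM rmorphXn /=.
(* A sign is its own inverse, so (-1)^(n-1) leaves the denominator unchanged. *)
rewrite -/(x j) invfM invr_sign mulrCA -[RHS]mulrA; congr (_ * _).
by rewrite [RHS]mulrCA mulNr mulrAC.
Qed.

End Nabla.

Section Indecomposables.
Variables (F : fieldType) (n : nat).
Local Notation S := [tuple mesym n F i.+1 | i < n].

(** A nonconstant monomial becomes a product with at least one factor lacking a constant term. *)
Lemma mcoeff0_comp_mpoly (lq : n.-tuple {mpoly F[n]}) (p : {mpoly F[n]}) :
  (forall i, (tnth lq i)@_0%MM = 0) -> (p \mPo lq)@_0%MM = p@_0%MM.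
Proof.
move=> lq0; elim/mpolyind: p => [|c m p _ _ IH]; first by rewrite comp_mpoly0.
rewrite comp_mpolyD comp_mpolyZ !mcoeffD !mcoeffZ IH; congr (_ * _ + _).
rewrite comp_mpolyX mcoeffX rmorph_prod /=.
under eq_bigr do rewrite rmorphXn /= lq0.
case: (eqVneq m 0%MM) => [->|m0].
  by rewrite big1 // => i _; rewrite mnmE expr0.
case: (pickP (fun i => m i != 0%N)) => [i mi|m_eq0].
  by rewrite (bigD1 i) //= expr0n (negPf mi) mul0r.
case/eqP: m0; apply/mnmP => i; rewrite mnmE.
by apply/eqP; move/negbFE: (m_eq0 i).
Qed.

(** The coefficient of x_i is the constant term of the derivative in x_i, to which the Leibniz rule
    applies. *)
Lemma mcoeffU_mulr0 (p q : {mpoly F[n]}) (i : 'I_n) :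
  p@_0%MM = 0 -> q@_0%MM = 0 -> (p * q)@_U_(i) = 0.
Proof.
move=> p0 q0; have := mcoeff_mderiv i (p * q) 0.
rewrite mderivM mcoeffD !rmorphM /= p0 q0 mul0r mulr0 addr0.
by rewrite add0m mnmE mulr1n.
Qed.

Lemma elemsym_notin_Rplus2 (i : 'I_n) :
  elemsym_plus F n i \notin @Rplus2_pred F n.
Proof.
apply/negP => /asboolP[l /(congr1 val)]; rewrite rmorph_sum /= => el.
have S0 j : (tnth S j)@_0%MM = 0.
  by rewrite tnth_mktuple; exact/eqP/(elemsym_Rplus F n j).
(* By the fundamental theorem f is a polynomial [t] in the e_j; as these have no constant term, [t]
   inherits its vanishing constant term from f. *)
have lift (f : Rplus F n) :
    {t | t \mPo S = val (val f) & t@_0%MM = 0}.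
  have sym_f : val (val f) \is symmetric.
    by apply/issymP => s; case: (val f) => p /= /inv_predP ->; rewrite ?inE.
  have [t [et _]] := sym_fundamental sym_f.
  by exists t => //; rewrite -(mcoeff0_comp_mpoly t S0) et; case: f {sym_f et} => f /= /eqP.
pose t f := s2val (lift f).
(* Algebraic independence of the e_j lifts the decomposition of e_(i+1) to one of the variable
   ['X_i], whose linear coefficient is 1 instead of 0. *)
have eT : 'X_i = \sum_(gh <- l) t gh.1 * t gh.2.
  apply: msym_fundamental_un; rewrite comp_mpolyXU -tnth_nth tnth_mktuple el.
  rewrite rmorph_sum; apply: eq_bigr => gh _.
  by rewrite rmorphM /= (s2valP (lift gh.1)) (s2valP (lift gh.2)).
have := congr1 (mcoeff U_(i)) eT.
rewrite mcoeffX eqxx raddf_sum big1 => [/eqP|gh _]; first by rewrite oner_eq0.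
by apply: mcoeffU_mulr0; rewrite (s2valP' (lift _)).
Qed.

End Indecomposables.

Theorem proposition5p4p1
    (F : closedFieldType) (charF : [pchar F] =i pred0)
    (n : nat) (n_gt0 : (0 < n)%N) :
  let x1 : 'I_n := Ordinal n_gt0 in
  let eta := xmu F x1 ^+ n in
  (forall i : 'I_n,
     nabla eta (elemsym F n i.+1) = (-1) ^+ n.-1 *: elemsym F n i.+1) /\
  (forall i : 'I_n, is_eigenweight (xmuXn_homog F x1) i ((-1) ^+ n.-1)).
Proof.
move=> x1 eta; split=> i; first exact: nabla_xmuXn_elemsym.
split.
  apply/eqP => cls0; have /negP := elemsym_notin_Rplus2 F i; apply.
  rewrite -[elemsym_plus F n i]subr0 Quotient.idealrBE.
  by apply/eqP; rewrite cls0 raddf0.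
rewrite nabla_barE; transitivity (\pi_(indec F n)%qT ((-1) ^+ n.-1 *: elemsym_plus F n i)).
  by congr (\pi_(indec F n)%qT _); apply: val_inj; apply: nabla_xmuXn_elemsym.
exact/esym/pi_scaleq.
Qed.
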